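(* The category $\mathsf{Rack}_{\mathrm{med}}$ of medial racks and the category $\mathsf{GLR}_{\mathrm{med}}$ of medial GL-racks are closed symmetric monoidal with respect to the medial tensor product $\otimes_{\mathrm{med}}$ in each category and the closed structures (internal homs) given by the hom-sets $\operatorname{Hom}_{\mathsf{Rack}_{\mathrm{med}}}(-,-)$ and $\operatorname{Hom}_{\mathsf{GLR}_{\mathrm{med}}}(-,-)$, respectively, equipped with their canonical pointwise medial rack (resp. medial GL-rack) structures.
   Context: A rack is a pair $(X,s)$ of a set $X$ and a map $s:X\to S_X$, $x\mapsto s_x$ ($S_X$ the group of permutations of $X$), such that $s_xs_y=s_{s_x(y)}s_x$ for all $x,y\in X$. It is medial if $s_{s_x(z)}s_y(a)=s_{s_x(y)}s_z(a)$ for all $x,y,z,a\in X$, i.e. if $(x,y)\mapsto s_x(y)$ is a rack homomorphism from the product rack $X\times X$ to $X$. A rack homomorphism $(X,s)\to(Y,t)$ is a map $\varphi:X\to Y$ with $\varphi s_x=t_{\varphi(x)}\varphi$ for all $x$. A GL-structure on $R=(X,s)$ is a rack automorphism $\mathtt{u}$ of $R$ with $\mathtt{u}s_x=s_x\mathtt{u}$ for all $x\in X$; $(R,\mathtt{u})$ is then a GL-rack, called medial if $R$ is medial. A GL-rack homomorphism $(R_1,\mathtt{u}_1)\to(R_2,\mathtt{u}_2)$ is a rack homomorphism $\varphi$ with $\varphi\mathtt{u}_1=\mathtt{u}_2\varphi$. $\mathsf{Rack}_{\mathrm{med}}$ and $\mathsf{GLR}_{\mathrm{med}}$ are the full subcategories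 of medial objects in the categories of racks and GL-racks. Racks form an algebraic theory with binary operations $s_-(-)$, $s^{-1}_-(-)$; GL-racks have additionally unary operations $\mathtt{u},\mathtt{u}^{-1}$; congruences are equivalence relations compatible with all operations. Free racks and free GL-racks on a set are free objects in the usual sense. Tensor product of racks $R_1=(X,r)$, $R_2=(Y,t)$: $R_1\otimes R_2$ is the free rack on $X\times Y$ (rack structure $s$, generators $x\otimes y:=(x,y)$) modulo the smallest congruence such that for all $x,x_1,x_2\in X$, $y,y_1,y_2\in Y$: (T1) $s_{x\otimes y_2}(x\otimes y_1)\sim x\otimes t_{y_2}(y_1)$ and $s^{-1}_{x\otimes y_2}(x\otimes y_1)\sim x\otimes t^{-1}_{y_2}(y_1)$; (T2) $s_{x_2\otimes y}(x_1\otimes y)\sim r_{x_2}(x_1)\otimes y$ and $s^{-1}_{x_2\otimes y}(x_1\otimes y)\sim r^{-1}_{x_2}(x_1)\otimes y$. For GL-racks $(X,r,\mathtt{u}_1)$, $(Y,t,\mathtt{u}_2)$: the free GL-rack on $X\times Y$ modulo the smallest congruence such that (T1), (T2) and (T3) $\mathtt{u}(x\otimes y)\sim\mathtt{u}_1(x)\otimes y\sim x\otimes\mathtt{u}_2(y)$ hold. The medialization $R_{\mathrm{med}}$ of a rack (resp. GL-rack) $R$ is its quotient by the smallest congruence such that $s_{s_x(z)}s_y(a)\sim s_{s_x(y)}s_z(a)$ for all $x,y,z,a$. The medial tensor product is $R_1\otimes_{\mathrm{med}}R_2:=(R_1\otimes R_2)_{\mathrm{med}}$. Canonical structures on hom-sets: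 for a rack $R=(X,s)$ and a medial rack $M=(Y,t)$, the set $H$ of rack homomorphisms $R\to M$ is a medial rack via $\widetilde{t}_g(f)(x):=t_{g(x)}f(x)$ for $f,g\in H$, $x\in X$. For GL-racks $(R,\mathtt{u}_1)$ and $(M,\mathtt{u}_2)$ with $M$ medial, the set of GL-rack homomorphisms is a subrack of this rack, and it is a medial GL-rack with GL-structure $f\mapsto\mathtt{u}_2f$. *)

(* Defs.v *)
#[warnings="-notation-overridden"]
From mathcomp Require Import all_boot.
From mathcomp Require Import boolp.

Set Implicit Arguments.
Unset Strict Implicit.
Unset Printing Implicit Defensive.

Local Open Scope quotient_scope.

Section Quotient.
Variables (T : Type) (E : T -> T -> Prop) (eqvE : RelationClasses.Equivalence E).

Let e (x y : {classic T}) : bool := `[< E x y >].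

Fact quot_refl : reflexive e.
Proof. by move=> x; apply/asboolP; apply: (@RelationClasses.Equivalence_Reflexive _ _ eqvE). Qed.

Fact quot_sym : symmetric e.
Proof.
by move=> x y; apply/asboolP/asboolP; apply: (@RelationClasses.Equivalence_Symmetric _ _ eqvE).
Qed.

Fact quot_trans : transitive e.
Proof.
move=> y x z /asboolP xy /asboolP yz; apply/asboolP.
exact: (@RelationClasses.Equivalence_Transitive _ _ eqvE) xy yz.
Qed.

Definition quot_equiv : equiv_rel {classic T} :=
  EquivRel e quot_refl quot_sym quot_trans.

Definition quot : Type := {eq_quot quot_equiv}.
Definition qpi (x : T) : quot := \pi_({eq_quot quot_equiv}) (x : {classic T}).
Definition qrepr (q : quot) : T := repr (q : {eq_quot quot_equiv}).

Lemma qreprK q : qpi (qrepr q) = q.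
Proof. exact: (@reprK _ {eq_quot quot_equiv}). Qed.

Lemma qpiP x y : qpi x = qpi y <-> E x y.
Proof.
by split=> [/(@eqmodP _ quot_equiv)/asboolP|/asboolP /(@eqmodP _ quot_equiv)].
Qed.

Lemma qrepr_pi x : E (qrepr (qpi x)) x.
Proof. by apply/qpiP; rewrite qreprK. Qed.

Lemma qpi_ind (P : quot -> Prop) : (forall x, P (qpi x)) -> forall q, P q.
Proof. by move=> Ppi q; rewrite -(qreprK q). Qed.

(* Locked, so that unification does not unfold the lifted operations. *)
Fact qlift_key : unit. Proof. exact: tt. Qed.
Definition qlift1 : (T -> T) -> quot -> quot :=
  locked_with qlift_key (fun f q => qpi (f (qrepr q))).
Definition qlift2 : (T -> T -> T) -> quot -> quot -> quot :=
  locked_with qlift_key (fun g p q => qpi (g (qrepr p) (qrepr q))).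

Lemma qlift1E f : (forall x x', E x x' -> E (f x) (f x')) ->
  forall x, qlift1 f (qpi x) = qpi (f x).
Proof. by move=> fE x; rewrite /qlift1 unlock; apply/qpiP/fE/qrepr_pi. Qed.

Lemma qlift2E g :
  (forall x x' y y', E x x' -> E y y' -> E (g x y) (g x' y')) ->
  forall x y, qlift2 g (qpi x) (qpi y) = qpi (g x y).
Proof. by move=> gE x y; rewrite /qlift2 unlock; apply/qpiP/gE; apply: qrepr_pi. Qed.

End Quotient.

(* [act x y] is s_x(y) and [iact x y] is s_x^{-1}(y); the permutation s_x is
   encoded by the map [act x] together with its (unique) inverse [iact x]. *)
Record rack := Rack {
  rack_sort :> Type;
  act : rack_sort -> rack_sort -> rack_sort;
  iact : rack_sort -> rack_sort -> rack_sort;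
  actK : forall x, cancel (act x) (iact x);
  iactK : forall x, cancel (iact x) (act x);
  act_act : forall x y z, act x (act y z) = act (act x y) (act x z)
}.

Definition medial (R : rack) : Prop :=
  forall x y z a : R, act (act x z) (act y a) = act (act x y) (act z a).

Record rack_hom (R S : rack) := RackHom {
  rack_hom_fun :> R -> S;
  rack_hom_act : forall x y, rack_hom_fun (act x y) = act (rack_hom_fun x) (rack_hom_fun y)
}.

Lemma rack_homP (R S : rack) (f g : rack_hom R S) : f =1 g -> f = g.
Proof.
case: f g => [f fH] [g gH] /= /funext fg; rewrite -{}fg in gH *.
by congr RackHom; apply: Prop_irrelevance.
Qed.

Lemma act_inj (R : rack) (x : R) : injective (act x).
Proof. exact: can_inj (actK x). Qed.

Lemma rack_hom_iact (R S : rack) (f : rack_hom R S) (x y : R) :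
  f (iact x y) = iact (f x) (f y).
Proof. by apply: (@act_inj S (f x)); rewrite -rack_hom_act !iactK. Qed.

Definition rack_id (R : rack) : rack_hom R R :=
  @RackHom R R (fun x => x) (fun x y => erefl).

Fact rack_comp_act (R S U : rack) (g : rack_hom S U) (f : rack_hom R S) (x y : R) :
  g (f (act x y)) = act (g (f x)) (g (f y)).
Proof. by rewrite !rack_hom_act. Qed.

Definition rack_comp (R S U : rack) (g : rack_hom S U) (f : rack_hom R S) :
  rack_hom R U := RackHom (rack_comp_act g f).

Record rack_congruence (R : rack) (E : R -> R -> Prop) : Prop := RackCongruence {
  rack_congr_eqv : RelationClasses.Equivalence E;
  rack_congr_act : forall x x' y y', E x x' -> E y y' -> E (act x y) (act x' y');
  rack_congr_iact : forall x x' y y', E x x' -> E y y' -> E (iact x y) (iact x' y')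
}.

Section RackQuotient.
Variables (R : rack) (E : R -> R -> Prop) (cE : rack_congruence E).

Let Q := quot (rack_congr_eqv cE).
Let pi : R -> Q := qpi (rack_congr_eqv cE).
Let qact : Q -> Q -> Q := qlift2 (@act R).
Let qiact : Q -> Q -> Q := qlift2 (@iact R).

Fact quot_actE x y : qact (pi x) (pi y) = pi (act x y).
Proof. exact/qlift2E/(rack_congr_act cE). Qed.

Fact quot_iactE x y : qiact (pi x) (pi y) = pi (iact x y).
Proof. exact/qlift2E/(rack_congr_iact cE). Qed.

Fact quot_actK x : cancel (qact x) (qiact x).
Proof.
move=> y; elim/qpi_ind: x => x; elim/qpi_ind: y => y.
by rewrite quot_actE quot_iactE actK.
Qed.

Fact quot_iactK x : cancel (qiact x) (qact x).
Proof.
move=> y; elim/qpi_ind: x => x; elim/qpi_ind: y => y.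
by rewrite quot_iactE quot_actE iactK.
Qed.

Fact quot_act_act x y z : qact x (qact y z) = qact (qact x y) (qact x z).
Proof.
elim/qpi_ind: x => x; elim/qpi_ind: y => y; elim/qpi_ind: z => z.
by rewrite !quot_actE act_act.
Qed.

Definition quot_rack : rack := Rack quot_actK quot_iactK quot_act_act.

Definition quot_pi : rack_hom R quot_rack :=
  @RackHom R quot_rack pi (fun x y => esym (quot_actE x y)).

Lemma quot_piP x y : quot_pi x = quot_pi y <-> E x y.
Proof. exact: qpiP. Qed.

Lemma quot_pi_ind (P : quot_rack -> Prop) : (forall x, P (quot_pi x)) -> forall q, P q.
Proof. exact: qpi_ind. Qed.

Section Lift.
Variables (S : rack) (f : rack_hom R S) (fE : forall x y, E x y -> f x = f y).

Let flift (q : quot_rack) : S := f (qrepr q).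

Fact quot_lift_pi x : flift (quot_pi x) = f x.
Proof. exact: fE (qrepr_pi (rack_congr_eqv cE) x). Qed.

Fact quot_lift_act p q : flift (act p q) = act (flift p) (flift q).
Proof.
elim/quot_pi_ind: p => x; elim/quot_pi_ind: q => y.
by rewrite -rack_hom_act !quot_lift_pi rack_hom_act.
Qed.

Definition quot_lift : rack_hom quot_rack S := RackHom quot_lift_act.

Lemma quot_liftE x : quot_lift (quot_pi x) = f x.
Proof. exact: quot_lift_pi. Qed.
End Lift.
End RackQuotient.

(* The smallest congruence on [R] containing the relation [B]. *)
Inductive rack_congr (R : rack) (B : R -> R -> Prop) : R -> R -> Prop :=
| rack_congr_base x y : B x y -> rack_congr B x y
| rack_congr_refl x : rack_congr B x x
| rack_congr_sym x y : rack_congr B x y -> rack_congr B y x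
| rack_congr_trans x y z : rack_congr B x y -> rack_congr B y z -> rack_congr B x z
| rack_congr_cact x x' y y' :
    rack_congr B x x' -> rack_congr B y y' -> rack_congr B (act x y) (act x' y')
| rack_congr_ciact x x' y y' :
    rack_congr B x x' -> rack_congr B y y' -> rack_congr B (iact x y) (iact x' y').

Lemma rack_congrP (R : rack) (B : R -> R -> Prop) : rack_congruence (rack_congr B).
Proof.
split; [split| |].
- exact: rack_congr_refl.
- exact: rack_congr_sym.
- exact: rack_congr_trans.
- exact: rack_congr_cact.
- exact: rack_congr_ciact.
Qed.

Lemma rack_congr_min (R : rack) (B E : R -> R -> Prop) :
  rack_congruence E -> (forall x y, B x y -> E x y) ->
  forall x y, rack_congr B x y -> E x y.
Proof.
move=> [[Er Es Et] Ea Ei] BE x y.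
elim=> [a b ab|a|a b _ ab|a b c _ ab _ bc|a a' b b' _ aa' _ bb'|a a' b b' _ aa' _ bb'].
- exact: BE.
- exact: Er.
- exact: Es.
- exact: Et ab bc.
- exact: Ea.
- exact: Ei.
Qed.

Lemma rack_congr_hom (R S : rack) (B : R -> R -> Prop) (f : rack_hom R S) :
  (forall x y, B x y -> f x = f y) -> forall x y, rack_congr B x y -> f x = f y.
Proof.
move=> fB; apply: rack_congr_min => //; split; first split.
- by [].
- by move=> x y ->.
- by move=> x y z -> ->.
- by move=> x x' y y' fx fy; rewrite !rack_hom_act fx fy.
- by move=> x x' y y' fx fy; rewrite !rack_hom_iact fx fy.
Qed.

Inductive rack_term (S : Type) : Type :=
| RVar of S
| RAct of rack_term S & rack_term S
| RIact of rack_term S & rack_term S.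

(* The smallest congruence on rack terms whose quotient is a rack. *)
Inductive rack_term_eq (S : Type) : rack_term S -> rack_term S -> Prop :=
| rteq_refl t : rack_term_eq t t
| rteq_sym t u : rack_term_eq t u -> rack_term_eq u t
| rteq_trans t u v : rack_term_eq t u -> rack_term_eq u v -> rack_term_eq t v
| rteq_act t t' u u' : rack_term_eq t t' -> rack_term_eq u u' ->
    rack_term_eq (RAct t u) (RAct t' u')
| rteq_iact t t' u u' : rack_term_eq t t' -> rack_term_eq u u' ->
    rack_term_eq (RIact t u) (RIact t' u')
| rteq_actK t u : rack_term_eq (RIact t (RAct t u)) u
| rteq_iactK t u : rack_term_eq (RAct t (RIact t u)) u
| rteq_act_act t u v :
    rack_term_eq (RAct t (RAct u v)) (RAct (RAct t u) (RAct t v)).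

Lemma rack_term_eqv (S : Type) : RelationClasses.Equivalence (@rack_term_eq S).
Proof. by split; [exact: rteq_refl|exact: rteq_sym|exact: rteq_trans]. Qed.

Section FreeRack.
Variable S : Type.

Let Q := quot (rack_term_eqv S).
Let pi : rack_term S -> Q := qpi (rack_term_eqv S).
Let fact : Q -> Q -> Q := qlift2 (@RAct S).
Let fiact : Q -> Q -> Q := qlift2 (@RIact S).

Fact free_actE t u : fact (pi t) (pi u) = pi (RAct t u).
Proof. exact/qlift2E/rteq_act. Qed.

Fact free_iactE t u : fiact (pi t) (pi u) = pi (RIact t u).
Proof. exact/qlift2E/rteq_iact. Qed.

Fact free_actK x : cancel (fact x) (fiact x).
Proof.
move=> y; elim/qpi_ind: x => x; elim/qpi_ind: y => y.
by rewrite free_actE free_iactE; apply/qpiP/rteq_actK.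
Qed.

Fact free_iactK x : cancel (fiact x) (fact x).
Proof.
move=> y; elim/qpi_ind: x => x; elim/qpi_ind: y => y.
by rewrite free_iactE free_actE; apply/qpiP/rteq_iactK.
Qed.

Fact free_act_act x y z : fact x (fact y z) = fact (fact x y) (fact x z).
Proof.
elim/qpi_ind: x => x; elim/qpi_ind: y => y; elim/qpi_ind: z => z.
by rewrite !free_actE; apply/qpiP/rteq_act_act.
Qed.

Definition free_rack : rack := Rack free_actK free_iactK free_act_act.

Definition free_gen (s : S) : free_rack := pi (RVar s).

Lemma free_rack_ind (P : free_rack -> Prop) :
  (forall s, P (free_gen s)) ->
  (forall x y, P x -> P y -> P (act x y)) ->
  (forall x y, P x -> P y -> P (iact x y)) -> forall x, P x.
Proof.
move=> Pg Pa Pi; elim/qpi_ind; elim=> [s|t Pt u Pu|t Pt u Pu]; first exact: Pg.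
- by have := Pa _ _ Pt Pu; rewrite /= free_actE.
- by have := Pi _ _ Pt Pu; rewrite /= free_iactE.
Qed.

Section Lift.
Variables (R : rack) (f : S -> R).

Fixpoint rack_eval (t : rack_term S) : R :=
  match t with
  | RVar s => f s
  | RAct t u => act (rack_eval t) (rack_eval u)
  | RIact t u => iact (rack_eval t) (rack_eval u)
  end.

Lemma rack_eval_eq t u : rack_term_eq t u -> rack_eval t = rack_eval u.
Proof.
elim=> //= {t u} [t u v _ -> _ -> //|t t' u u' _ -> _ -> //|t t' u u' _ -> _ -> //|t u|t u|t u v].
- exact: actK.
- exact: iactK.
- exact: act_act.
Qed.

Let flift (x : free_rack) : R := rack_eval (qrepr x).

Let flift_pi t : flift (pi t) = rack_eval t.
Proof. exact: rack_eval_eq (qrepr_pi (rack_term_eqv S) t). Qed.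

Fact free_lift_act x y : flift (act x y) = act (flift x) (flift y).
Proof.
elim/qpi_ind: x => t; elim/qpi_ind: y => u.
by rewrite [act _ _]free_actE !flift_pi.
Qed.

Definition free_lift : rack_hom free_rack R := RackHom free_lift_act.

Lemma free_liftE s : free_lift (free_gen s) = f s.
Proof. exact: flift_pi. Qed.
End Lift.

Lemma free_hom_ext (R : rack) (g h : rack_hom free_rack R) :
  (forall s, g (free_gen s) = h (free_gen s)) -> g = h.
Proof.
move=> gh; apply: rack_homP; apply: free_rack_ind => // x y gx gy.
- by rewrite !rack_hom_act gx gy.
- by rewrite !rack_hom_iact gx gy.
Qed.
End FreeRack.

Inductive tensor_rel (R1 R2 : rack) :
  free_rack (R1 * R2) -> free_rack (R1 * R2) -> Prop :=
| tensor_T1 x y1 y2 :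
    tensor_rel (act (free_gen (x, y2)) (free_gen (x, y1))) (free_gen (x, act y2 y1))
| tensor_T1V x y1 y2 :
    tensor_rel (iact (free_gen (x, y2)) (free_gen (x, y1))) (free_gen (x, iact y2 y1))
| tensor_T2 x1 x2 y :
    tensor_rel (act (free_gen (x2, y)) (free_gen (x1, y))) (free_gen (act x2 x1, y))
| tensor_T2V x1 x2 y :
    tensor_rel (iact (free_gen (x2, y)) (free_gen (x1, y))) (free_gen (iact x2 x1, y)).

Definition tensor (R1 R2 : rack) : rack := quot_rack (rack_congrP (@tensor_rel R1 R2)).

Inductive medial_rel (R : rack) : R -> R -> Prop :=
| MedialRel x y z a :
    medial_rel (act (act x z) (act y a)) (act (act x y) (act z a)).

Definition medialization (R : rack) : rack := quot_rack (rack_congrP (@medial_rel R)).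

Definition med_tensor (R1 R2 : rack) : rack := medialization (tensor R1 R2).

Lemma medialization_medial (R : rack) : medial (medialization R).
Proof.
move=> x y z a; elim/quot_pi_ind: x => x; elim/quot_pi_ind: y => y.
elim/quot_pi_ind: z => z; elim/quot_pi_ind: a => a; rewrite -!rack_hom_act.
by apply/quot_piP/rack_congr_base.
Qed.

Section MedTensor.
Variables R1 R2 : rack.

Definition med_tens (x : R1) (y : R2) : med_tensor R1 R2 :=
  quot_pi (rack_congrP (@medial_rel _))
    (quot_pi (rack_congrP (@tensor_rel R1 R2)) (free_gen (x, y))).

Lemma med_tens_actr x y1 y2 :
  med_tens x (act y2 y1) = act (med_tens x y2) (med_tens x y1).
Proof.
rewrite /med_tens -!rack_hom_act; congr (quot_pi _ _); apply/esym/quot_piP.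
exact/rack_congr_base/tensor_T1.
Qed.

Lemma med_tens_actl x1 x2 y :
  med_tens (act x2 x1) y = act (med_tens x2 y) (med_tens x1 y).
Proof.
rewrite /med_tens -!rack_hom_act; congr (quot_pi _ _); apply/esym/quot_piP.
exact/rack_congr_base/tensor_T2.
Qed.

Lemma med_tensor_ext (R : rack) (g h : rack_hom (med_tensor R1 R2) R) :
  (forall x y, g (med_tens x y) = h (med_tens x y)) -> g = h.
Proof.
move=> gh; apply: rack_homP; elim/quot_pi_ind; elim/quot_pi_ind => t.
pose p := rack_comp (quot_pi (rack_congrP (@medial_rel _)))
  (quot_pi (rack_congrP (@tensor_rel R1 R2))).
suff /(congr1 (fun k : rack_hom _ _ => k t)) : rack_comp g p = rack_comp h p by [].
by apply: free_hom_ext => -[x y]; apply: gh.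
Qed.

Section Lift.
Variables (M : rack) (medM : medial M) (b : R1 -> R2 -> M).
Hypothesis b_actl : forall x1 x2 y, b (act x2 x1) y = act (b x2 y) (b x1 y).
Hypothesis b_actr : forall x y1 y2, b x (act y2 y1) = act (b x y2) (b x y1).

Let b0 : rack_hom (free_rack (R1 * R2)) M := free_lift (fun p => b p.1 p.2).

Fact tensor_lift_rel s t : rack_congr (@tensor_rel R1 R2) s t -> b0 s = b0 t.
Proof.
apply: rack_congr_hom => _ _ [x y1 y2|x y1 y2|x1 x2 y|x1 x2 y].
- by rewrite rack_hom_act !free_liftE /= b_actr.
- by rewrite rack_hom_iact !free_liftE /=; apply: (@act_inj M (b x y2)); rewrite -b_actr !iactK.
- by rewrite rack_hom_act !free_liftE /= b_actl.
- by rewrite rack_hom_iact !free_liftE /=; apply: (@act_inj M (b x2 y)); rewrite -b_actl !iactK.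
Qed.

Definition tensor_lift : rack_hom (tensor R1 R2) M :=
  quot_lift (rack_congrP (@tensor_rel R1 R2)) tensor_lift_rel.

Fact med_tensor_lift_rel s t :
  rack_congr (@medial_rel (tensor R1 R2)) s t -> tensor_lift s = tensor_lift t.
Proof. by apply: rack_congr_hom => _ _ [x y z a]; rewrite !rack_hom_act medM. Qed.

Definition med_tensor_lift : rack_hom (med_tensor R1 R2) M :=
  quot_lift (rack_congrP (@medial_rel _)) med_tensor_lift_rel.

Lemma med_tensor_liftE x y : med_tensor_lift (med_tens x y) = b x y.
Proof. by rewrite /med_tens !quot_liftE free_liftE. Qed.
End Lift.
End MedTensor.

Section MedTensorMap.
Variables (A A' B B' : rack) (f : rack_hom A A') (g : rack_hom B B').

Fact med_tensor_map_actl x1 x2 y :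
  med_tens (f (act x2 x1)) (g y) = act (med_tens (f x2) (g y)) (med_tens (f x1) (g y)).
Proof. by rewrite rack_hom_act med_tens_actl. Qed.

Fact med_tensor_map_actr x y1 y2 :
  med_tens (f x) (g (act y2 y1)) = act (med_tens (f x) (g y2)) (med_tens (f x) (g y1)).
Proof. by rewrite rack_hom_act med_tens_actr. Qed.

Definition med_tensor_map : rack_hom (med_tensor A B) (med_tensor A' B') :=
  med_tensor_lift (@medialization_medial _) med_tensor_map_actl med_tensor_map_actr.

Lemma med_tensor_mapE x y : med_tensor_map (med_tens x y) = med_tens (f x) (g y).
Proof. exact: med_tensor_liftE. Qed.
End MedTensorMap.

Section HomRack.
Variables (R M : rack) (medM : medial M).

Fact hom_act_subproof (g f : rack_hom R M) x y :
  act (g (act x y)) (f (act x y)) = act (act (g x) (f x)) (act (g y) (f y)).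
Proof. by rewrite !rack_hom_act medM. Qed.

Definition hom_act (g f : rack_hom R M) : rack_hom R M :=
  @RackHom R M (fun x => act (g x) (f x)) (hom_act_subproof g f).

Fact hom_iact_subproof (g f : rack_hom R M) x y :
  iact (g (act x y)) (f (act x y)) = act (iact (g x) (f x)) (iact (g y) (f y)).
Proof.
apply: (@act_inj M (g (act x y))).
by rewrite iactK !rack_hom_act medM !iactK.
Qed.

Definition hom_iact (g f : rack_hom R M) : rack_hom R M :=
  @RackHom R M (fun x => iact (g x) (f x)) (hom_iact_subproof g f).

Fact hom_actK g : cancel (hom_act g) (hom_iact g).
Proof. by move=> f; apply: rack_homP => x; apply: actK. Qed.

Fact hom_iactK g : cancel (hom_iact g) (hom_act g).
Proof. by move=> f; apply: rack_homP => x; apply: iactK. Qed.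

Fact hom_act_act f g h : hom_act f (hom_act g h) = hom_act (hom_act f g) (hom_act f h).
Proof. by apply: rack_homP => x; apply: act_act. Qed.

Definition hom_rack : rack := Rack hom_actK hom_iactK hom_act_act.

Lemma hom_rack_medial : medial hom_rack.
Proof. by move=> f g h k; apply: rack_homP => x; apply: medM. Qed.
End HomRack.

Section HomRackMap.
Variables (A A' M M' : rack) (medM : medial M) (medM' : medial M').
Variables (f : rack_hom A' A) (g : rack_hom M M').

Fact hom_rack_map_act (h k : hom_rack A medM) :
  rack_comp g (rack_comp (act h k : rack_hom A M) f) =
  act (rack_comp g (rack_comp h f) : hom_rack A' medM') (rack_comp g (rack_comp k f)).
Proof. by apply: rack_homP => x; apply: rack_hom_act. Qed.

Definition hom_rack_map : rack_hom (hom_rack A medM) (hom_rack A' medM') :=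
  @RackHom (hom_rack A medM) (hom_rack A' medM')
    (fun h => rack_comp g (rack_comp h f)) hom_rack_map_act.
End HomRackMap.

(* [gl_u] is the GL-structure u and [gl_ui] its inverse. *)
Record gl_rack := GLRack {
  gl_rack_rack :> rack;
  gl_u : gl_rack_rack -> gl_rack_rack;
  gl_ui : gl_rack_rack -> gl_rack_rack;
  gl_uK : cancel gl_u gl_ui;
  gl_uiK : cancel gl_ui gl_u;
  gl_u_act : forall x y, gl_u (act x y) = act (gl_u x) (gl_u y);
  gl_u_comm : forall x y, gl_u (act x y) = act x (gl_u y)
}.

Record gl_hom (R S : gl_rack) := GLHom {
  gl_hom_rhom :> rack_hom R S;
  gl_hom_u : forall x, gl_hom_rhom (gl_u x) = gl_u (gl_hom_rhom x)
}.

Lemma gl_homP (R S : gl_rack) (f g : gl_hom R S) : f =1 g -> f = g.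
Proof.
case: f g => [f fH] [g gH] /= /rack_homP fg; rewrite -{}fg in gH *.
by congr GLHom; apply: Prop_irrelevance.
Qed.

Lemma gl_hom_ui (R S : gl_rack) (f : gl_hom R S) x : f (gl_ui x) = gl_ui (f x).
Proof. by apply: (can_inj (@gl_uK S)); rewrite -gl_hom_u !gl_uiK. Qed.

Definition gl_id (R : gl_rack) : gl_hom R R := @GLHom R R (rack_id R) (fun x => erefl).

Fact gl_comp_u (R S U : gl_rack) (g : gl_hom S U) (f : gl_hom R S) (x : R) :
  g (f (gl_u x)) = gl_u (g (f x)).
Proof. by rewrite !gl_hom_u. Qed.

Definition gl_comp (R S U : gl_rack) (g : gl_hom S U) (f : gl_hom R S) : gl_hom R U :=
  @GLHom R U (rack_comp g f) (gl_comp_u g f).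

Record gl_congruence (R : gl_rack) (E : R -> R -> Prop) : Prop := GLCongruence {
  gl_congr_rack : rack_congruence E;
  gl_congr_u : forall x x', E x x' -> E (gl_u x) (gl_u x');
  gl_congr_ui : forall x x', E x x' -> E (gl_ui x) (gl_ui x')
}.

Section GLQuotient.
Variables (R : gl_rack) (E : R -> R -> Prop) (cE : gl_congruence E).

Let Q := quot_rack (gl_congr_rack cE).
Let pi : rack_hom R Q := quot_pi (gl_congr_rack cE).
Let qu : Q -> Q := qlift1 (@gl_u R).
Let qui : Q -> Q := qlift1 (@gl_ui R).

Fact gl_quot_uE x : qu (pi x) = pi (gl_u x).
Proof. exact/qlift1E/(gl_congr_u cE). Qed.

Fact gl_quot_uiE x : qui (pi x) = pi (gl_ui x).
Proof. exact/qlift1E/(gl_congr_ui cE). Qed.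

Fact gl_quot_uK : cancel qu qui.
Proof. by elim/quot_pi_ind => x; rewrite gl_quot_uE gl_quot_uiE gl_uK. Qed.

Fact gl_quot_uiK : cancel qui qu.
Proof. by elim/quot_pi_ind => x; rewrite gl_quot_uiE gl_quot_uE gl_uiK. Qed.

Fact gl_quot_u_act x y : qu (act x y) = act (qu x) (qu y).
Proof.
elim/quot_pi_ind: x => x; elim/quot_pi_ind: y => y.
by rewrite -rack_hom_act !gl_quot_uE gl_u_act rack_hom_act.
Qed.

Fact gl_quot_u_comm x y : qu (act x y) = act x (qu y).
Proof.
elim/quot_pi_ind: x => x; elim/quot_pi_ind: y => y.
by rewrite -rack_hom_act !gl_quot_uE gl_u_comm rack_hom_act.
Qed.

Definition gl_quot : gl_rack := GLRack gl_quot_uK gl_quot_uiK gl_quot_u_act gl_quot_u_comm.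

Definition gl_quot_pi : gl_hom R gl_quot :=
  @GLHom R gl_quot pi (fun x => esym (gl_quot_uE x)).

Lemma gl_quot_piP x y : gl_quot_pi x = gl_quot_pi y <-> E x y.
Proof. exact: qpiP. Qed.

Lemma gl_quot_pi_ind (P : gl_quot -> Prop) : (forall x, P (gl_quot_pi x)) -> forall q, P q.
Proof. exact: quot_pi_ind. Qed.

Section Lift.
Variables (S : gl_rack) (f : gl_hom R S) (fE : forall x y, E x y -> f x = f y).

Let flift : rack_hom gl_quot S := quot_lift (gl_congr_rack cE) fE.

Fact gl_quot_lift_u q : flift (gl_u q) = gl_u (flift q).
Proof.
by elim/gl_quot_pi_ind: q => x; rewrite -gl_hom_u !quot_liftE gl_hom_u.
Qed.

Definition gl_quot_lift : gl_hom gl_quot S := GLHom gl_quot_lift_u.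

Lemma gl_quot_liftE x : gl_quot_lift (gl_quot_pi x) = f x.
Proof. exact: quot_liftE. Qed.
End Lift.
End GLQuotient.

(* The smallest GL-rack congruence on [R] containing the relation [B]. *)
Inductive gl_congr (R : gl_rack) (B : R -> R -> Prop) : R -> R -> Prop :=
| gl_congr_base x y : B x y -> gl_congr B x y
| gl_congr_refl x : gl_congr B x x
| gl_congr_sym x y : gl_congr B x y -> gl_congr B y x
| gl_congr_trans x y z : gl_congr B x y -> gl_congr B y z -> gl_congr B x z
| gl_congr_cact x x' y y' :
    gl_congr B x x' -> gl_congr B y y' -> gl_congr B (act x y) (act x' y')
| gl_congr_ciact x x' y y' :
    gl_congr B x x' -> gl_congr B y y' -> gl_congr B (iact x y) (iact x' y')
| gl_congr_cu x x' : gl_congr B x x' -> gl_congr B (gl_u x) (gl_u x')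
| gl_congr_cui x x' : gl_congr B x x' -> gl_congr B (gl_ui x) (gl_ui x').

Lemma gl_congrP (R : gl_rack) (B : R -> R -> Prop) : gl_congruence (gl_congr B).
Proof.
split; [split; [split| |]| |].
- exact: gl_congr_refl.
- exact: gl_congr_sym.
- exact: gl_congr_trans.
- exact: gl_congr_cact.
- exact: gl_congr_ciact.
- exact: gl_congr_cu.
- exact: gl_congr_cui.
Qed.

Lemma gl_congr_min (R : gl_rack) (B E : R -> R -> Prop) :
  gl_congruence E -> (forall x y, B x y -> E x y) ->
  forall x y, gl_congr B x y -> E x y.
Proof.
move=> [[[Er Es Et] Ea Ei] Eu Eui] BE x y.
elim=> [a b ab|a|a b _ ab|a b c _ ab _ bc|a a' b b' _ aa' _ bb'|a a' b b' _ aa' _ bb'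
  |a a' _ aa'|a a' _ aa'].
- exact: BE.
- exact: Er.
- exact: Es.
- exact: Et ab bc.
- exact: Ea.
- exact: Ei.
- exact: Eu.
- exact: Eui.
Qed.

Lemma gl_congr_hom (R S : gl_rack) (B : R -> R -> Prop) (f : gl_hom R S) :
  (forall x y, B x y -> f x = f y) -> forall x y, gl_congr B x y -> f x = f y.
Proof.
move=> fB; apply: gl_congr_min => //; split; [split; first split| |].
- by [].
- by move=> x y ->.
- by move=> x y z -> ->.
- by move=> x x' y y' fx fy; rewrite !rack_hom_act fx fy.
- by move=> x x' y y' fx fy; rewrite !rack_hom_iact fx fy.
- by move=> x x' fx; rewrite !gl_hom_u fx.
- by move=> x x' fx; rewrite !gl_hom_ui fx.
Qed.

Inductive gl_term (S : Type) : Type :=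
| GVar of S
| GAct of gl_term S & gl_term S
| GIact of gl_term S & gl_term S
| GU of gl_term S
| GUi of gl_term S.

(* The smallest congruence on GL-rack terms whose quotient is a GL-rack. *)
Inductive gl_term_eq (S : Type) : gl_term S -> gl_term S -> Prop :=
| gteq_refl t : gl_term_eq t t
| gteq_sym t u : gl_term_eq t u -> gl_term_eq u t
| gteq_trans t u v : gl_term_eq t u -> gl_term_eq u v -> gl_term_eq t v
| gteq_act t t' u u' : gl_term_eq t t' -> gl_term_eq u u' ->
    gl_term_eq (GAct t u) (GAct t' u')
| gteq_iact t t' u u' : gl_term_eq t t' -> gl_term_eq u u' ->
    gl_term_eq (GIact t u) (GIact t' u')
| gteq_u t t' : gl_term_eq t t' -> gl_term_eq (GU t) (GU t')
| gteq_ui t t' : gl_term_eq t t' -> gl_term_eq (GUi t) (GUi t')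
| gteq_actK t u : gl_term_eq (GIact t (GAct t u)) u
| gteq_iactK t u : gl_term_eq (GAct t (GIact t u)) u
| gteq_act_act t u v :
    gl_term_eq (GAct t (GAct u v)) (GAct (GAct t u) (GAct t v))
| gteq_uK t : gl_term_eq (GUi (GU t)) t
| gteq_uiK t : gl_term_eq (GU (GUi t)) t
| gteq_u_act t u : gl_term_eq (GU (GAct t u)) (GAct (GU t) (GU u))
| gteq_u_comm t u : gl_term_eq (GU (GAct t u)) (GAct t (GU u)).

Lemma gl_term_eqv (S : Type) : RelationClasses.Equivalence (@gl_term_eq S).
Proof. by split; [exact: gteq_refl|exact: gteq_sym|exact: gteq_trans]. Qed.

Section FreeGLRack.
Variable S : Type.

Let Q := quot (gl_term_eqv S).
Let pi : gl_term S -> Q := qpi (gl_term_eqv S).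
Let fact : Q -> Q -> Q := qlift2 (@GAct S).
Let fiact : Q -> Q -> Q := qlift2 (@GIact S).
Let fu : Q -> Q := qlift1 (@GU S).
Let fui : Q -> Q := qlift1 (@GUi S).

Fact gl_free_actE t u : fact (pi t) (pi u) = pi (GAct t u).
Proof. exact/qlift2E/gteq_act. Qed.

Fact gl_free_iactE t u : fiact (pi t) (pi u) = pi (GIact t u).
Proof. exact/qlift2E/gteq_iact. Qed.

Fact gl_free_uE t : fu (pi t) = pi (GU t).
Proof. exact/qlift1E/gteq_u. Qed.

Fact gl_free_uiE t : fui (pi t) = pi (GUi t).
Proof. exact/qlift1E/gteq_ui. Qed.

Fact gl_free_actK x : cancel (fact x) (fiact x).
Proof.
move=> y; elim/qpi_ind: x => x; elim/qpi_ind: y => y.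
by rewrite gl_free_actE gl_free_iactE; apply/qpiP/gteq_actK.
Qed.

Fact gl_free_iactK x : cancel (fiact x) (fact x).
Proof.
move=> y; elim/qpi_ind: x => x; elim/qpi_ind: y => y.
by rewrite gl_free_iactE gl_free_actE; apply/qpiP/gteq_iactK.
Qed.

Fact gl_free_act_act x y z : fact x (fact y z) = fact (fact x y) (fact x z).
Proof.
elim/qpi_ind: x => x; elim/qpi_ind: y => y; elim/qpi_ind: z => z.
by rewrite !gl_free_actE; apply/qpiP/gteq_act_act.
Qed.

Definition gl_free_as_rack : rack := Rack gl_free_actK gl_free_iactK gl_free_act_act.

Fact gl_free_uK : cancel fu fui.
Proof. by elim/qpi_ind => t; rewrite gl_free_uE gl_free_uiE; apply/qpiP/gteq_uK. Qed.

Fact gl_free_uiK : cancel fui fu.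
Proof. by elim/qpi_ind => t; rewrite gl_free_uiE gl_free_uE; apply/qpiP/gteq_uiK. Qed.

Fact gl_free_u_act x y : fu (fact x y) = fact (fu x) (fu y).
Proof.
elim/qpi_ind: x => x; elim/qpi_ind: y => y.
by rewrite !gl_free_uE !gl_free_actE gl_free_uE; apply/qpiP/gteq_u_act.
Qed.

Fact gl_free_u_comm x y : fu (fact x y) = fact x (fu y).
Proof.
elim/qpi_ind: x => x; elim/qpi_ind: y => y.
by rewrite !gl_free_uE !gl_free_actE gl_free_uE; apply/qpiP/gteq_u_comm.
Qed.

Definition gl_free : gl_rack :=
  @GLRack gl_free_as_rack _ _ gl_free_uK gl_free_uiK gl_free_u_act gl_free_u_comm.

Definition gl_free_gen (s : S) : gl_free := pi (GVar s).

Lemma gl_free_ind (P : gl_free -> Prop) :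
  (forall s, P (gl_free_gen s)) ->
  (forall x y, P x -> P y -> P (act x y)) ->
  (forall x y, P x -> P y -> P (iact x y)) ->
  (forall x, P x -> P (gl_u x)) ->
  (forall x, P x -> P (gl_ui x)) -> forall x, P x.
Proof.
move=> Pg Pa Pi Pu Pui; elim/qpi_ind.
elim=> [s|t Pt u Pu'|t Pt u Pu'|t Pt|t Pt]; first exact: Pg.
- by have := Pa _ _ Pt Pu'; rewrite /= gl_free_actE.
- by have := Pi _ _ Pt Pu'; rewrite /= gl_free_iactE.
- by have := Pu _ Pt; rewrite /= gl_free_uE.
- by have := Pui _ Pt; rewrite /= gl_free_uiE.
Qed.

Section Lift.
Variables (R : gl_rack) (f : S -> R).

Fixpoint gl_eval (t : gl_term S) : R :=
  match t with
  | GVar s => f s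
  | GAct t u => act (gl_eval t) (gl_eval u)
  | GIact t u => iact (gl_eval t) (gl_eval u)
  | GU t => gl_u (gl_eval t)
  | GUi t => gl_ui (gl_eval t)
  end.

Lemma gl_eval_eq t u : gl_term_eq t u -> gl_eval t = gl_eval u.
Proof.
elim=> //= {t u} [t u v _ -> _ -> //|t t' u u' _ -> _ -> //|t t' u u' _ -> _ -> //
  |t t' _ -> //|t t' _ -> //|t u|t u|t u v|t|t|t u|t u].
- exact: actK.
- exact: iactK.
- exact: act_act.
- exact: gl_uK.
- exact: gl_uiK.
- exact: gl_u_act.
- exact: gl_u_comm.
Qed.

Let flift (x : gl_free) : R := gl_eval (qrepr x).

Let flift_pi t : flift (pi t) = gl_eval t.
Proof. exact: gl_eval_eq (qrepr_pi (gl_term_eqv S) t). Qed.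

Fact gl_free_lift_act x y : flift (act x y) = act (flift x) (flift y).
Proof.
elim/qpi_ind: x => t; elim/qpi_ind: y => u.
by rewrite [act _ _]gl_free_actE !flift_pi.
Qed.

Fact gl_free_lift_u x : flift (gl_u x) = gl_u (flift x).
Proof. by elim/qpi_ind: x => t; rewrite [gl_u _]gl_free_uE !flift_pi. Qed.

Definition gl_free_lift : gl_hom gl_free R :=
  @GLHom gl_free R (RackHom gl_free_lift_act) gl_free_lift_u.

Lemma gl_free_liftE s : gl_free_lift (gl_free_gen s) = f s.
Proof. exact: flift_pi. Qed.
End Lift.

Lemma gl_free_hom_ext (R : gl_rack) (g h : gl_hom gl_free R) :
  (forall s, g (gl_free_gen s) = h (gl_free_gen s)) -> g = h.
Proof.
move=> gh; apply: gl_homP; apply: gl_free_ind => // [x y gx gy|x y gx gy|x gx|x gx].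
- by rewrite !rack_hom_act gx gy.
- by rewrite !rack_hom_iact gx gy.
- by rewrite !gl_hom_u gx.
- by rewrite !gl_hom_ui gx.
Qed.
End FreeGLRack.

Inductive gl_tensor_rel (R1 R2 : gl_rack) :
  gl_free (R1 * R2) -> gl_free (R1 * R2) -> Prop :=
| gl_tensor_T1 x y1 y2 :
    gl_tensor_rel (act (gl_free_gen (x, y2)) (gl_free_gen (x, y1)))
                  (gl_free_gen (x, act y2 y1))
| gl_tensor_T1V x y1 y2 :
    gl_tensor_rel (iact (gl_free_gen (x, y2)) (gl_free_gen (x, y1)))
                  (gl_free_gen (x, iact y2 y1))
| gl_tensor_T2 x1 x2 y :
    gl_tensor_rel (act (gl_free_gen (x2, y)) (gl_free_gen (x1, y)))
                  (gl_free_gen (act x2 x1, y))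
| gl_tensor_T2V x1 x2 y :
    gl_tensor_rel (iact (gl_free_gen (x2, y)) (gl_free_gen (x1, y)))
                  (gl_free_gen (iact x2 x1, y))
| gl_tensor_T3l x y :
    gl_tensor_rel (gl_u (gl_free_gen (x, y))) (gl_free_gen (gl_u x, y))
| gl_tensor_T3r x y :
    gl_tensor_rel (gl_free_gen (gl_u x, y)) (gl_free_gen (x, gl_u y)).

Definition gl_tensor (R1 R2 : gl_rack) : gl_rack :=
  gl_quot (gl_congrP (@gl_tensor_rel R1 R2)).

Definition gl_medialization (R : gl_rack) : gl_rack :=
  gl_quot (gl_congrP (@medial_rel R)).

Definition gl_med_tensor (R1 R2 : gl_rack) : gl_rack :=
  gl_medialization (gl_tensor R1 R2).

Lemma gl_medialization_medial (R : gl_rack) : medial (gl_medialization R).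
Proof.
move=> x y z a; elim/gl_quot_pi_ind: x => x; elim/gl_quot_pi_ind: y => y.
elim/gl_quot_pi_ind: z => z; elim/gl_quot_pi_ind: a => a; rewrite -!rack_hom_act.
by apply/gl_quot_piP/gl_congr_base.
Qed.

Section GLMedTensor.
Variables R1 R2 : gl_rack.

Definition gl_med_tens (x : R1) (y : R2) : gl_med_tensor R1 R2 :=
  gl_quot_pi (gl_congrP (@medial_rel _))
    (gl_quot_pi (gl_congrP (@gl_tensor_rel R1 R2)) (gl_free_gen (x, y))).

Lemma gl_med_tens_actr x y1 y2 :
  gl_med_tens x (act y2 y1) = act (gl_med_tens x y2) (gl_med_tens x y1).
Proof.
rewrite /gl_med_tens -!rack_hom_act; congr (gl_quot_pi _ _); apply/esym/gl_quot_piP.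
exact/gl_congr_base/gl_tensor_T1.
Qed.

Lemma gl_med_tens_actl x1 x2 y :
  gl_med_tens (act x2 x1) y = act (gl_med_tens x2 y) (gl_med_tens x1 y).
Proof.
rewrite /gl_med_tens -!rack_hom_act; congr (gl_quot_pi _ _); apply/esym/gl_quot_piP.
exact/gl_congr_base/gl_tensor_T2.
Qed.

Lemma gl_med_tens_ul x y : gl_med_tens (gl_u x) y = gl_u (gl_med_tens x y).
Proof.
rewrite /gl_med_tens -!gl_hom_u; congr (gl_quot_pi _ _); apply/esym/gl_quot_piP.
exact/gl_congr_base/gl_tensor_T3l.
Qed.

Lemma gl_med_tens_ur x y : gl_med_tens x (gl_u y) = gl_u (gl_med_tens x y).
Proof.
rewrite -gl_med_tens_ul /gl_med_tens; congr (gl_quot_pi _ _); apply/esym/gl_quot_piP.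
exact/gl_congr_base/gl_tensor_T3r.
Qed.

Lemma gl_med_tensor_ext (R : gl_rack) (g h : gl_hom (gl_med_tensor R1 R2) R) :
  (forall x y, g (gl_med_tens x y) = h (gl_med_tens x y)) -> g = h.
Proof.
move=> gh; apply: gl_homP; elim/gl_quot_pi_ind; elim/gl_quot_pi_ind => t.
pose p := gl_comp (gl_quot_pi (gl_congrP (@medial_rel _)))
  (gl_quot_pi (gl_congrP (@gl_tensor_rel R1 R2))).
suff /(congr1 (fun k : gl_hom _ _ => k t)) : gl_comp g p = gl_comp h p by [].
by apply: gl_free_hom_ext => -[x y]; apply: gh.
Qed.

Section Lift.
Variables (M : gl_rack) (medM : medial M) (b : R1 -> R2 -> M).
Hypothesis b_actl : forall x1 x2 y, b (act x2 x1) y = act (b x2 y) (b x1 y).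
Hypothesis b_actr : forall x y1 y2, b x (act y2 y1) = act (b x y2) (b x y1).
Hypothesis b_ul : forall x y, b (gl_u x) y = gl_u (b x y).
Hypothesis b_ur : forall x y, b x (gl_u y) = gl_u (b x y).

Let b0 : gl_hom (gl_free (R1 * R2)) M := gl_free_lift (fun p => b p.1 p.2).

Fact gl_tensor_lift_rel s t : gl_congr (@gl_tensor_rel R1 R2) s t -> b0 s = b0 t.
Proof.
apply: gl_congr_hom => _ _ [x y1 y2|x y1 y2|x1 x2 y|x1 x2 y|x y|x y].
- by rewrite rack_hom_act !gl_free_liftE /= b_actr.
- by rewrite rack_hom_iact !gl_free_liftE /=; apply: (@act_inj M (b x y2)); rewrite -b_actr !iactK.
- by rewrite rack_hom_act !gl_free_liftE /= b_actl.
- by rewrite rack_hom_iact !gl_free_liftE /=; apply: (@act_inj M (b x2 y)); rewrite -b_actl !iactK.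
- by rewrite gl_hom_u !gl_free_liftE /= b_ul.
- by rewrite !gl_free_liftE /= b_ul b_ur.
Qed.

Definition gl_tensor_lift : gl_hom (gl_tensor R1 R2) M :=
  gl_quot_lift (gl_congrP (@gl_tensor_rel R1 R2)) gl_tensor_lift_rel.

Fact gl_med_tensor_lift_rel s t :
  gl_congr (@medial_rel (gl_tensor R1 R2)) s t -> gl_tensor_lift s = gl_tensor_lift t.
Proof. by apply: gl_congr_hom => _ _ [x y z a]; rewrite !rack_hom_act medM. Qed.

Definition gl_med_tensor_lift : gl_hom (gl_med_tensor R1 R2) M :=
  gl_quot_lift (gl_congrP (@medial_rel _)) gl_med_tensor_lift_rel.

Lemma gl_med_tensor_liftE x y : gl_med_tensor_lift (gl_med_tens x y) = b x y.
Proof. by rewrite /gl_med_tens !gl_quot_liftE gl_free_liftE. Qed.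
End Lift.
End GLMedTensor.

Section GLMedTensorMap.
Variables (A A' B B' : gl_rack) (f : gl_hom A A') (g : gl_hom B B').

Fact gl_med_tensor_map_actl x1 x2 y :
  gl_med_tens (f (act x2 x1)) (g y) =
  act (gl_med_tens (f x2) (g y)) (gl_med_tens (f x1) (g y)).
Proof. by rewrite rack_hom_act gl_med_tens_actl. Qed.

Fact gl_med_tensor_map_actr x y1 y2 :
  gl_med_tens (f x) (g (act y2 y1)) =
  act (gl_med_tens (f x) (g y2)) (gl_med_tens (f x) (g y1)).
Proof. by rewrite rack_hom_act gl_med_tens_actr. Qed.

Fact gl_med_tensor_map_ul x y :
  gl_med_tens (f (gl_u x)) (g y) = gl_u (gl_med_tens (f x) (g y)).
Proof. by rewrite gl_hom_u gl_med_tens_ul. Qed.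

Fact gl_med_tensor_map_ur x y :
  gl_med_tens (f x) (g (gl_u y)) = gl_u (gl_med_tens (f x) (g y)).
Proof. by rewrite gl_hom_u gl_med_tens_ur. Qed.

Definition gl_med_tensor_map : gl_hom (gl_med_tensor A B) (gl_med_tensor A' B') :=
  gl_med_tensor_lift (@gl_medialization_medial _) gl_med_tensor_map_actl
    gl_med_tensor_map_actr gl_med_tensor_map_ul gl_med_tensor_map_ur.

Lemma gl_med_tensor_mapE x y :
  gl_med_tensor_map (gl_med_tens x y) = gl_med_tens (f x) (g y).
Proof. exact: gl_med_tensor_liftE. Qed.
End GLMedTensorMap.

Section HomGLRack.
Variables (R M : gl_rack) (medM : medial M).

Lemma gl_ui_comm (x y : M) : gl_ui (act x y) = act x (gl_ui y).
Proof. by apply: (can_inj (@gl_uK M)); rewrite gl_uiK gl_u_comm gl_uiK. Qed.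

Lemma gl_ui_act (x y : M) : gl_ui (act x y) = act (gl_ui x) (gl_ui y).
Proof. by apply: (can_inj (@gl_uK M)); rewrite gl_u_act !gl_uiK. Qed.

Fact gl_hom_act_u (g f : gl_hom R M) x :
  hom_act medM g f (gl_u x) = gl_u (hom_act medM g f x).
Proof. by rewrite /= !gl_hom_u gl_u_act. Qed.

Definition gl_hom_act (g f : gl_hom R M) : gl_hom R M := GLHom (gl_hom_act_u g f).

Fact gl_hom_iact_u (g f : gl_hom R M) x :
  hom_iact medM g f (gl_u x) = gl_u (hom_iact medM g f x).
Proof.
apply: (@act_inj M (g (gl_u x))).
by rewrite /= iactK !gl_hom_u -gl_u_act iactK.
Qed.

Definition gl_hom_iact (g f : gl_hom R M) : gl_hom R M := GLHom (gl_hom_iact_u g f).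

Fact gl_hom_actK g : cancel (gl_hom_act g) (gl_hom_iact g).
Proof. by move=> f; apply: gl_homP => x; apply: actK. Qed.

Fact gl_hom_iactK g : cancel (gl_hom_iact g) (gl_hom_act g).
Proof. by move=> f; apply: gl_homP => x; apply: iactK. Qed.

Fact gl_hom_act_act f g h :
  gl_hom_act f (gl_hom_act g h) = gl_hom_act (gl_hom_act f g) (gl_hom_act f h).
Proof. by apply: gl_homP => x; apply: act_act. Qed.

Definition gl_hom_as_rack : rack := Rack gl_hom_actK gl_hom_iactK gl_hom_act_act.

Fact gl_post_u_act (f : gl_hom R M) x y : gl_u (f (act x y)) = act (gl_u (f x)) (gl_u (f y)).
Proof. by rewrite rack_hom_act gl_u_act. Qed.

Fact gl_post_u_u (f : gl_hom R M) x : gl_u (f (gl_u x)) = gl_u (gl_u (f x)).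
Proof. by rewrite gl_hom_u. Qed.

Definition gl_post_u (f : gl_hom R M) : gl_hom R M :=
  @GLHom R M (@RackHom R M (fun x => gl_u (f x)) (gl_post_u_act f)) (gl_post_u_u f).

Fact gl_post_ui_act (f : gl_hom R M) x y :
  gl_ui (f (act x y)) = act (gl_ui (f x)) (gl_ui (f y)).
Proof. by rewrite rack_hom_act gl_ui_act. Qed.

Fact gl_post_ui_u (f : gl_hom R M) x : gl_ui (f (gl_u x)) = gl_u (gl_ui (f x)).
Proof. by rewrite gl_hom_u gl_uK gl_uiK. Qed.

Definition gl_post_ui (f : gl_hom R M) : gl_hom R M :=
  @GLHom R M (@RackHom R M (fun x => gl_ui (f x)) (gl_post_ui_act f)) (gl_post_ui_u f).

Fact gl_post_uK : cancel gl_post_u gl_post_ui.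
Proof. by move=> f; apply: gl_homP => x; apply: gl_uK. Qed.

Fact gl_post_uiK : cancel gl_post_ui gl_post_u.
Proof. by move=> f; apply: gl_homP => x; apply: gl_uiK. Qed.

Fact gl_post_u_hom g f : gl_post_u (gl_hom_act g f) = gl_hom_act (gl_post_u g) (gl_post_u f).
Proof. by apply: gl_homP => x; apply: gl_u_act. Qed.

Fact gl_post_u_comm g f : gl_post_u (gl_hom_act g f) = gl_hom_act g (gl_post_u f).
Proof. by apply: gl_homP => x; apply: gl_u_comm. Qed.

Definition gl_hom_rack : gl_rack :=
  @GLRack gl_hom_as_rack _ _ gl_post_uK gl_post_uiK gl_post_u_hom gl_post_u_comm.

Lemma gl_hom_rack_medial : medial gl_hom_rack.
Proof. by move=> f g h k; apply: gl_homP => x; apply: medM. Qed.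
End HomGLRack.

Section HomGLRackMap.
Variables (A A' M M' : gl_rack) (medM : medial M) (medM' : medial M').
Variables (f : gl_hom A' A) (g : gl_hom M M').

Let F (h : gl_hom_rack A medM) : gl_hom_rack A' medM' :=
  gl_comp g (gl_comp h f).

Fact hom_gl_rack_map_act h k : F (act h k) = act (F h) (F k).
Proof. by apply: gl_homP => x; apply: rack_hom_act. Qed.

Fact hom_gl_rack_map_u h : F (gl_u h) = gl_u (F h).
Proof. by apply: gl_homP => x; apply: gl_hom_u. Qed.

Definition gl_hom_rack_map : gl_hom (gl_hom_rack A medM) (gl_hom_rack A' medM') :=
  @GLHom (gl_hom_rack A medM) (gl_hom_rack A' medM')
    (RackHom hom_gl_rack_map_act) hom_gl_rack_map_u.
End HomGLRackMap.

Record category := Category {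
  ob :> Type;
  hom : ob -> ob -> Type;
  idm : forall A, hom A A;
  comp : forall A B C, hom B C -> hom A B -> hom A C;
  comp1m : forall A B (f : hom A B), comp (idm B) f = f;
  compm1 : forall A B (f : hom A B), comp f (idm A) = f;
  compA : forall A B C D (h : hom C D) (g : hom B C) (f : hom A B),
    comp h (comp g f) = comp (comp h g) f
}.
Arguments idm {c} A.
Arguments comp {c A B C} g f.

Notation "g \oc f" := (comp g f) (at level 40, left associativity).

Definition is_iso (C : category) (A B : C) (f : hom A B) : Prop :=
  exists g : hom B A, g \oc f = idm A /\ f \oc g = idm B.

Definition op_cat (C : category) : category :=
  @Category C (fun A B => hom B A) (fun A => idm A) (fun _ _ _ g f => f \oc g)
    (fun A B f => compm1 f) (fun A B f => comp1m f)
    (fun _ _ _ _ h g f => esym (compA f g h)).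

Section ProductCategory.
Variables C D : category.

Definition prod_hom (X Y : C * D) : Type := (hom X.1 Y.1 * hom X.2 Y.2)%type.
Definition prod_comp (X Y Z : C * D) (g : prod_hom Y Z) (f : prod_hom X Y) : prod_hom X Z :=
  (g.1 \oc f.1, g.2 \oc f.2).

Fact prod_comp1m X Y (f : prod_hom X Y) : prod_comp (idm Y.1, idm Y.2) f = f.
Proof. by case: f => f1 f2; rewrite /prod_comp /= !comp1m. Qed.

Fact prod_compm1 X Y (f : prod_hom X Y) : prod_comp f (idm X.1, idm X.2) = f.
Proof. by case: f => f1 f2; rewrite /prod_comp /= !compm1. Qed.

Fact prod_compA X Y Z W (h : prod_hom Z W) (g : prod_hom Y Z) (f : prod_hom X Y) :
  prod_comp h (prod_comp g f) = prod_comp (prod_comp h g) f.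
Proof. by rewrite /prod_comp /= !compA. Qed.

Definition prod_cat : category :=
  @Category (C * D) prod_hom (fun X => (idm X.1, idm X.2)) prod_comp
    prod_comp1m prod_compm1 prod_compA.
End ProductCategory.

Definition full_subcat (C : category) (P : C -> Prop) : category :=
  @Category {A : C | P A} (fun A B => hom (sval A) (sval B))
    (fun A => idm (sval A)) (fun _ _ _ g f => g \oc f)
    (fun _ _ f => comp1m f) (fun _ _ f => compm1 f) (fun _ _ _ _ h g f => compA h g f).

Record functor (C D : category) := Functor {
  fob :> C -> D;
  fmap : forall A B, hom A B -> hom (fob A) (fob B);
  fmap_id : forall A, fmap (idm A) = idm (fob A);
  fmap_comp : forall A B E (g : hom B E) (f : hom A B), fmap (g \oc f) = fmap g \oc fmap f
}.
Arguments fmap {C D} f {A B} _ : rename.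

Section ClosedSymmetricMonoidal.
Variables (C : category).
Variables (T : functor (prod_cat C C) C) (H : functor (prod_cat (op_cat C) C) C).

Local Notation "A [x] B" := (fob T (A, B)) (at level 35, no associativity).

Definition tmap (A A' B B' : C) (f : hom A A') (g : hom B B') : hom (A [x] B) (A' [x] B') :=
  @fmap _ _ T (A, B) (A', B') (f, g).
Local Notation "f [*] g" := (tmap f g) (at level 35, no associativity).

Definition ihom (A B : C) : C := fob H (A, B).

Definition imap (A A' B B' : C) (f : hom A' A) (g : hom B B') : hom (ihom A B) (ihom A' B') :=
  @fmap _ _ H (A, B) (A', B') (f, g).

Record symmetric_monoidal := SymmetricMonoidal {
  unit_ob : C;
  assoc : forall A B D : C, hom ((A [x] B) [x] D) (A [x] (B [x] D));
  lunit : forall A : C, hom (unit_ob [x] A) A;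
  runit : forall A : C, hom (A [x] unit_ob) A;
  braid : forall A B : C, hom (A [x] B) (B [x] A);
  assoc_iso : forall A B D, is_iso (assoc A B D);
  lunit_iso : forall A, is_iso (lunit A);
  runit_iso : forall A, is_iso (runit A);
  assoc_nat : forall A A' B B' D D' (f : hom A A') (g : hom B B') (h : hom D D'),
    assoc A' B' D' \oc ((f [*] g) [*] h) = (f [*] (g [*] h)) \oc assoc A B D;
  lunit_nat : forall A A' (f : hom A A'),
    lunit A' \oc (idm unit_ob [*] f) = f \oc lunit A;
  runit_nat : forall A A' (f : hom A A'),
    runit A' \oc (f [*] idm unit_ob) = f \oc runit A;
  braid_nat : forall A A' B B' (f : hom A A') (g : hom B B'),
    braid A' B' \oc (f [*] g) = (g [*] f) \oc braid A B;
  triangle : forall A B,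
    (idm A [*] lunit B) \oc assoc A unit_ob B = runit A [*] idm B;
  pentagon : forall A B D E,
    assoc A B (D [x] E) \oc assoc (A [x] B) D E =
    (idm A [*] assoc B D E) \oc assoc A (B [x] D) E \oc (assoc A B D [*] idm E);
  hexagon : forall A B D,
    assoc B D A \oc braid A (B [x] D) \oc assoc A B D =
    (idm B [*] braid A D) \oc assoc B A D \oc (braid A B [*] idm D);
  braidK : forall A B, braid B A \oc braid A B = idm (A [x] B)
}.

(* The tensor-hom adjunction: - [x] B is left adjoint to [B, -] for every B,
   naturally in B as well. *)
Record closed_structure := ClosedStructure {
  curry : forall A B D : C, hom (A [x] B) D -> hom A (ihom B D);
  curry_bij : forall A B D, bijective (@curry A B D);
  curry_nat : forall A A' B B' D D'
      (a : hom A' A) (b : hom B' B) (d : hom D D') (f : hom (A [x] B) D),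
    curry (d \oc f \oc (a [*] b)) = imap b d \oc curry f \oc a
}.

Definition is_closed_symmetric_monoidal : Prop :=
  inhabited symmetric_monoidal /\ inhabited closed_structure.
End ClosedSymmetricMonoidal.

Fact rack_comp1m (R S : rack) (f : rack_hom R S) : rack_comp (rack_id S) f = f.
Proof. exact: rack_homP. Qed.

Fact rack_compm1 (R S : rack) (f : rack_hom R S) : rack_comp f (rack_id R) = f.
Proof. exact: rack_homP. Qed.

Fact rack_compA (R S U V : rack) (h : rack_hom U V) (g : rack_hom S U) (f : rack_hom R S) :
  rack_comp h (rack_comp g f) = rack_comp (rack_comp h g) f.
Proof. exact: rack_homP. Qed.

Definition Rack_cat : category := Category rack_comp1m rack_compm1 rack_compA.

Fact gl_comp1m (R S : gl_rack) (f : gl_hom R S) : gl_comp (gl_id S) f = f.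
Proof. exact: gl_homP. Qed.

Fact gl_compm1 (R S : gl_rack) (f : gl_hom R S) : gl_comp f (gl_id R) = f.
Proof. exact: gl_homP. Qed.

Fact gl_compA (R S U V : gl_rack) (h : gl_hom U V) (g : gl_hom S U) (f : gl_hom R S) :
  gl_comp h (gl_comp g f) = gl_comp (gl_comp h g) f.
Proof. exact: gl_homP. Qed.

Definition GLR_cat : category := Category gl_comp1m gl_compm1 gl_compA.

Definition Rack_med : category := @full_subcat Rack_cat (fun R : rack => medial R).
Definition GLR_med : category := @full_subcat GLR_cat (fun R : gl_rack => medial R).

Definition med_tensor_fob (X : prod_cat Rack_med Rack_med) : Rack_med :=
  exist (fun R : rack => medial R) (med_tensor (sval X.1) (sval X.2))
    (@medialization_medial _).

Definition med_tensor_fmap (X Y : prod_cat Rack_med Rack_med) (f : hom X Y) :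
  hom (med_tensor_fob X) (med_tensor_fob Y) := med_tensor_map f.1 f.2.

Fact med_tensor_fmap_id X : med_tensor_fmap (idm X) = idm (med_tensor_fob X).
Proof. by apply: med_tensor_ext => x y; apply: med_tensor_mapE. Qed.

Fact med_tensor_fmap_comp X Y Z (g : hom Y Z) (f : hom X Y) :
  med_tensor_fmap (g \oc f) = med_tensor_fmap g \oc med_tensor_fmap f.
Proof.
apply: med_tensor_ext => x y; apply: etrans (med_tensor_mapE _ _ x y) _.
apply/esym; apply: etrans (congr1 (med_tensor_fmap g : rack_hom _ _) (med_tensor_mapE f.1 f.2 x y)) _.
exact: med_tensor_mapE.
Qed.

Definition med_tensor_functor : functor (prod_cat Rack_med Rack_med) Rack_med :=
  Functor med_tensor_fmap_id med_tensor_fmap_comp.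

Definition hom_rack_fob (X : prod_cat (op_cat Rack_med) Rack_med) : Rack_med :=
  exist (fun R : rack => medial R) (hom_rack (sval X.1) (svalP X.2))
    (@hom_rack_medial _ _ _).

Definition hom_rack_fmap (X Y : prod_cat (op_cat Rack_med) Rack_med) (f : hom X Y) :
  hom (hom_rack_fob X) (hom_rack_fob Y) := hom_rack_map (svalP X.2) (svalP Y.2) f.1 f.2.

Fact hom_rack_fmap_id X : hom_rack_fmap (idm X) = idm (hom_rack_fob X).
Proof. by apply: rack_homP => h; apply: rack_homP. Qed.

Fact hom_rack_fmap_comp X Y Z (g : hom Y Z) (f : hom X Y) :
  hom_rack_fmap (g \oc f) = hom_rack_fmap g \oc hom_rack_fmap f.
Proof. by apply: rack_homP => h; apply: rack_homP. Qed.

Definition hom_rack_functor : functor (prod_cat (op_cat Rack_med) Rack_med) Rack_med :=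
  Functor hom_rack_fmap_id hom_rack_fmap_comp.

Definition gl_med_tensor_fob (X : prod_cat GLR_med GLR_med) : GLR_med :=
  exist (fun R : gl_rack => medial R) (gl_med_tensor (sval X.1) (sval X.2))
    (@gl_medialization_medial _).

Definition gl_med_tensor_fmap (X Y : prod_cat GLR_med GLR_med) (f : hom X Y) :
  hom (gl_med_tensor_fob X) (gl_med_tensor_fob Y) := gl_med_tensor_map f.1 f.2.

Fact gl_med_tensor_fmap_id X : gl_med_tensor_fmap (idm X) = idm (gl_med_tensor_fob X).
Proof. by apply: gl_med_tensor_ext => x y; apply: gl_med_tensor_mapE. Qed.

Fact gl_med_tensor_fmap_comp X Y Z (g : hom Y Z) (f : hom X Y) :
  gl_med_tensor_fmap (g \oc f) = gl_med_tensor_fmap g \oc gl_med_tensor_fmap f.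
Proof.
apply: gl_med_tensor_ext => x y; apply: etrans (gl_med_tensor_mapE _ _ x y) _.
apply/esym; apply: etrans (congr1 (gl_med_tensor_fmap g : gl_hom _ _) (gl_med_tensor_mapE f.1 f.2 x y)) _.
exact: gl_med_tensor_mapE.
Qed.

Definition gl_med_tensor_functor : functor (prod_cat GLR_med GLR_med) GLR_med :=
  Functor gl_med_tensor_fmap_id gl_med_tensor_fmap_comp.

Definition gl_hom_rack_fob (X : prod_cat (op_cat GLR_med) GLR_med) : GLR_med :=
  exist (fun R : gl_rack => medial R) (gl_hom_rack (sval X.1) (svalP X.2))
    (@gl_hom_rack_medial _ _ _).

Definition gl_hom_rack_fmap (X Y : prod_cat (op_cat GLR_med) GLR_med) (f : hom X Y) :
  hom (gl_hom_rack_fob X) (gl_hom_rack_fob Y) := gl_hom_rack_map (svalP X.2) (svalP Y.2) f.1 f.2.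

Fact gl_hom_rack_fmap_id X : gl_hom_rack_fmap (idm X) = idm (gl_hom_rack_fob X).
Proof. by apply: gl_homP => h; apply: gl_homP. Qed.

Fact gl_hom_rack_fmap_comp X Y Z (g : hom Y Z) (f : hom X Y) :
  gl_hom_rack_fmap (g \oc f) = gl_hom_rack_fmap g \oc gl_hom_rack_fmap f.
Proof. by apply: gl_homP => h; apply: gl_homP. Qed.

Definition gl_hom_rack_functor : functor (prod_cat (op_cat GLR_med) GLR_med) GLR_med :=
  Functor gl_hom_rack_fmap_id gl_hom_rack_fmap_comp.

(* Main.v *)
From mathcomp Require Import all_boot.
From mathcomp Require Import boolp.
Require Import Defs.

Set Implicit Arguments.
Unset Strict Implicit.
Unset Printing Implicit Defensive.

(** Both categories are concrete, and in both of them a map which is a morphism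
    in each of two variables ("bilinear") factors uniquely through the tensor
    product, while a map into the internal hom is a morphism as soon as it is
    one pointwise.  The latter says that a bilinear map [A -> B -> D] is the
    same thing as a morphism [A -> Hom(B, D)]; this gives the adjunction, and
    also makes trilinear maps factor through threefold tensor products, whence
    the associator.  The unit is the free object on one generator [e] (it is
    medial since all its translations coincide), and the coherence laws are
    equalities of morphisms agreeing on tensors of elements. *)

(** * Concrete categories and bilinear maps *)

Record concrete (C : category) := Concrete {
  el : C -> Type;
  ev : forall A B : C, hom A B -> el A -> el B;
  ev_id : forall A x, ev (idm A) x = x;
  ev_comp : forall A B D (g : hom B D) (f : hom A B) x, ev (g \oc f) x = ev g (ev f x);
  ev_inj : forall A B (f g : hom A B), ev f =1 ev g -> f = g
}.
Arguments ev {C} U {A B} f x : rename.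

Definition is_hom (C : category) (U : concrete C) (A B : C) (f : el U A -> el U B) : Prop :=
  exists h : hom A B, ev U h =1 f.

Definition bilinear (C : category) (U : concrete C) (A B D : C)
    (b : el U A -> el U B -> el U D) : Prop :=
  (forall y, is_hom (b^~ y)) /\ (forall x, is_hom (b x)).

(** As [H] is an arbitrary functor, elements of [ihom H A B] need not be literally morphisms;
    [ihom_hom] mediates between the two. The field [is_hom_ihom] encodes that the structure on an
    internal hom is pointwise. *)
Record bilinear_model (C : category) (U : concrete C)
    (T : functor (prod_cat C C) C) (H : functor (prod_cat (op_cat C) C) C) := BilinearModel {
  tens : forall A B : C, el U A -> el U B -> el U (T (A, B));
  tens_bilinear : forall A B, bilinear (@tens A B);
  tens_lift : forall A B D (b : el U A -> el U B -> el U D), bilinear b ->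
    exists h : hom (T (A, B)) D, forall x y, ev U h (tens x y) = b x y;
  tens_ext : forall A B D (g h : hom (T (A, B)) D),
    (forall x y, ev U g (tens x y) = ev U h (tens x y)) -> g = h;
  tens_tmap : forall A A' B B' (f : hom A A') (g : hom B B') x y,
    ev U (tmap T f g) (tens x y) = tens (ev U f x) (ev U g y);
  ihom_hom : forall A B, el U (ihom H A B) -> hom A B;
  ihom_hom_bij : forall A B, bijective (@ihom_hom A B);
  ihom_hom_imap : forall A A' B B' (f : hom A' A) (g : hom B B') k,
    ihom_hom (ev U (imap H f g) k) = g \oc (ihom_hom k) \oc f;
  is_hom_ihom : forall A B D (k : el U A -> el U (ihom H B D)),
    is_hom k <-> forall y, is_hom (fun x => ev U (ihom_hom (k x)) y);
  gen_ob : C;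
  gen : el U gen_ob;
  gen_lift : forall A (x : el U A), exists h : hom gen_ob A, ev U h gen = x;
  gen_ext : forall A (g h : hom gen_ob A), ev U g gen = ev U h gen -> g = h
}.
Arguments tens {C U T H} m {A B} x y : rename.
Arguments ihom_hom {C U T H} m {A B} k : rename.
Arguments gen {C U T H} m : rename.

(** * Extensionality and lifting for tensor products *)

Section BilinearModelTheory.
Variables (C : category) (U : concrete C).
Variables (T : functor (prod_cat C C) C) (H : functor (prod_cat (op_cat C) C) C).
Variable (m : bilinear_model U T H).

Local Notation "A [x] B" := (fob T (A, B)) (at level 35, no associativity).
Local Notation "x @@ y" := (tens m x y) (at level 35, no associativity).
Local Notation I := (gen_ob m).
Local Notation e := (gen m).

Lemma is_hom_ev A B (f : hom A B) : is_hom (ev U f).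
Proof. by exists f. Qed.

Lemma eq_is_hom A B (f g : el U A -> el U B) : f =1 g -> is_hom f -> is_hom g.
Proof. by move=> fg [h hf]; exists h => x; rewrite hf fg. Qed.

Lemma is_hom_comp A B D (g : el U B -> el U D) (f : el U A -> el U B) :
  is_hom g -> is_hom f -> is_hom (g \o f).
Proof. by move=> [h hg] [k kf]; exists (h \oc k) => x; rewrite ev_comp hg kf. Qed.

Lemma is_hom_tensl A B (y : el U B) : is_hom (fun x : el U A => x @@ y).
Proof. exact: (tens_bilinear m A B).1. Qed.

Lemma is_hom_tensr A B (x : el U A) : is_hom (fun y : el U B => x @@ y).
Proof. exact: (tens_bilinear m A B).2. Qed.

Arguments is_hom_tensl {A B} y.
Arguments is_hom_tensr {A B} x.

(** Phrasing this for functions rather than morphisms lets it apply to an expression in which all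
    variables but one are frozen. *)
Lemma is_hom_gen_ext A (f g : el U I -> el U A) : is_hom f -> is_hom g -> f e = g e -> f =1 g.
Proof. by move=> [h hf] [k kg]; rewrite -hf -kg => /gen_ext hk x; rewrite -hf -kg hk. Qed.

Lemma is_hom_tens_ext A B D (f g : el U (A [x] B) -> el U D) :
  is_hom f -> is_hom g -> (forall x y, f (x @@ y) = g (x @@ y)) -> f =1 g.
Proof.
move=> [h hf] [k kg] fg t; rewrite -hf -kg.
by congr (ev U _ t); apply: (tens_ext (b0 := m)) => x y; rewrite hf kg.
Qed.

(** With [z] fixed, both sides are morphisms in the element [t] of the inner product, so that [t]
    may be taken to be a tensor. *)
Lemma tens_ext3 A B D E (f g : hom ((A [x] B) [x] D) E) :
  (forall x y z, ev U f ((x @@ y) @@ z) = ev U g ((x @@ y) @@ z)) -> f = g.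
Proof.
move=> fg; apply: (tens_ext (b0 := m)) => t z; move: t.
apply: is_hom_tens_ext => [| |x y]; last exact: fg.
- by apply: (is_hom_comp (is_hom_ev f)); apply: is_hom_tensl.
- by apply: (is_hom_comp (is_hom_ev g)); apply: is_hom_tensl.
Qed.

Lemma ihom_ext A B (k l : el U (ihom H A B)) :
  (forall x, ev U (ihom_hom m k) x = ev U (ihom_hom m l) x) -> k = l.
Proof. by move=> kl; apply: (bij_inj (ihom_hom_bij m A B)); apply: (@ev_inj _ U). Qed.

Fact ihom_hom_surj A B (f : hom A B) : exists k, ihom_hom m k = f.
Proof. by have [g _ gK] := ihom_hom_bij m A B; exists (g f). Qed.

(** The inverse of [ihom_hom] is obtained by choice, since bijectivity only asserts its
    existence. *)
Definition ihom_of A B (f : hom A B) : el U (ihom H A B) := sval (cid (ihom_hom_surj f)).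

Lemma ihom_ofK A B (f : hom A B) : ihom_hom m (ihom_of f) = f.
Proof. exact: svalP (cid (ihom_hom_surj f)). Qed.

Definition tlift A B D (b : el U A -> el U B -> el U D) (bb : bilinear b) :
  hom (A [x] B) D := sval (cid (tens_lift m bb)).

Lemma tliftE A B D (b : el U A -> el U B -> el U D) (bb : bilinear b) x y :
  ev U (tlift bb) (x @@ y) = b x y.
Proof. exact: svalP (cid (tens_lift m bb)) x y. Qed.

(** The last variable is absorbed into the internal hom: [k x y] represents the morphism [c x y]. By
    the pointwise criterion [k] is bilinear, so it lifts to the inner product. *)
Lemma tens_lift3 A B D E (c : el U A -> el U B -> el U D -> el U E) :
  (forall y z, is_hom (fun x => c x y z)) -> (forall x z, is_hom (fun y => c x y z)) ->
  (forall x y, is_hom (c x y)) ->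
  exists h : hom ((A [x] B) [x] D) E, forall x y z, ev U h ((x @@ y) @@ z) = c x y z.
Proof.
move=> c1 c2 c3; pose k x y := ihom_of (sval (cid (c3 x y))).
have kE x y z : ev U (ihom_hom m (k x y)) z = c x y z.
  by rewrite ihom_ofK; apply: (svalP (cid (c3 x y))).
have kbil : bilinear k.
  by split=> [y|x]; apply/(is_hom_ihom m) => z;
    [apply: eq_is_hom (c1 y z)|apply: eq_is_hom (c2 x z)] => u; rewrite kE.
(* Uncurrying the lift of [k] gives a bilinear map on the outer product, which is lifted in turn. *)
have bbil : bilinear (fun t z => ev U (ihom_hom m (ev U (tlift kbil) t)) z).
  split=> [|t]; last exact: is_hom_ev.
  by apply/(is_hom_ihom m); apply: is_hom_ev.
by exists (tlift bbil) => x y z; rewrite !tliftE kE.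
Qed.

(** * Braiding, associator and unitors *)

Definition mbraid A B : hom (A [x] B) (B [x] A) :=
  tlift (conj (@is_hom_tensr B A) (@is_hom_tensl B A)).

Lemma mbraidE A B x y : ev U (mbraid A B) (x @@ y) = y @@ x.
Proof. exact: tliftE. Qed.

Fact massoc_subproof A B D : exists h : hom ((A [x] B) [x] D) (A [x] (B [x] D)),
  forall x y z, ev U h ((x @@ y) @@ z) = x @@ (y @@ z).
Proof.
apply: tens_lift3 => [y z|x z|x y]; first exact: is_hom_tensl.
- exact: (is_hom_comp (is_hom_tensr x) (is_hom_tensl z)).
- exact: (is_hom_comp (is_hom_tensr x) (is_hom_tensr y)).
Qed.

Definition massoc A B D : hom ((A [x] B) [x] D) (A [x] (B [x] D)) :=
  sval (cid (massoc_subproof A B D)).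

Lemma massocE A B D x y z : ev U (massoc A B D) ((x @@ y) @@ z) = x @@ (y @@ z).
Proof. exact: svalP (cid (massoc_subproof A B D)) x y z. Qed.

(* Reverse both products, reassociate, and reverse back. *)
Definition massocV A B D : hom (A [x] (B [x] D)) ((A [x] B) [x] D) :=
  mbraid D (A [x] B) \oc (tmap T (idm D) (mbraid B A)) \oc massoc D B A
  \oc (tmap T (mbraid B D) (idm A)) \oc mbraid A (B [x] D).

Lemma massocVE A B D x y z : ev U (massocV A B D) (x @@ (y @@ z)) = (x @@ y) @@ z.
Proof.
rewrite !(ev_comp, mbraidE).
by rewrite !(tens_tmap, mbraidE, ev_id, massocE).
Qed.

Fact mlunit_subproof A : exists h : hom (I [x] A) A, forall x, ev U h (e @@ x) = x.
Proof.
(* Freeness of the unit yields [l] from [I] to the internal hom of [A] with itself, taking [e] to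
   the identity; the left unitor is [l] uncurried. *)
have [l le] := gen_lift m (ihom_of (idm A)).
have bl : bilinear (fun i => ev U (ihom_hom m (ev U l i))).
  split=> [|i]; last exact: is_hom_ev.
  by apply/(is_hom_ihom m); apply: is_hom_ev.
by exists (tlift bl) => x; rewrite tliftE le ihom_ofK ev_id.
Qed.

Definition mlunit A : hom (I [x] A) A := sval (cid (mlunit_subproof A)).

Lemma mlunitE A x : ev U (mlunit A) (e @@ x) = x.
Proof. exact: svalP (cid (mlunit_subproof A)) x. Qed.

Definition mrunit A : hom (A [x] I) A := mlunit A \oc mbraid A I.

Lemma mrunitE A x : ev U (mrunit A) (x @@ e) = x.
Proof. by rewrite ev_comp mbraidE mlunitE. Qed.

(** For fixed [x] both sides are morphisms out of the free object [I], hence determined by their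
    value at [e]. *)
Lemma tens_unitl_ext A B (f g : hom (I [x] A) B) :
  (forall x, ev U f (e @@ x) = ev U g (e @@ x)) -> f = g.
Proof.
move=> fg; apply: (tens_ext (b0 := m)) => i x; move: i.
apply: is_hom_gen_ext => [| |]; last exact: fg.
- exact: (is_hom_comp (is_hom_ev f) (is_hom_tensl x)).
- exact: (is_hom_comp (is_hom_ev g) (is_hom_tensl x)).
Qed.

Lemma mbraidK A B : mbraid B A \oc mbraid A B = idm (A [x] B).
Proof. by apply: (tens_ext (b0 := m)) => x y; rewrite ev_comp !mbraidE ev_id. Qed.

Lemma tens_unitr_ext A B (f g : hom (A [x] I) B) :
  (forall x, ev U f (x @@ e) = ev U g (x @@ e)) -> f = g.
Proof.
(* Writing the identity as a double braiding moves the unit to the left factor. *)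
move=> fg; rewrite -[f]compm1 -[g]compm1 -mbraidK !compA; congr (_ \oc _).
by apply: tens_unitl_ext => x; rewrite !ev_comp mbraidE.
Qed.

Lemma is_iso_comp (A B D : C) (g : hom B D) (f : hom A B) : is_iso g -> is_iso f -> is_iso (g \oc f).
Proof.
move=> [g' [g'g gg']] [f' [f'f ff']]; exists (f' \oc g'); split.
- by rewrite compA -(compA f') g'g compm1.
- by rewrite compA -(compA g) ff' compm1.
Qed.

Lemma mlunit_iso A : is_iso (mlunit A).
Proof.
(* The inverse inserts the generator on the left; it is a morphism by linearity in the second
   variable. *)
have [h hE] := is_hom_tensr (e : el U I) : is_hom (fun x : el U A => e @@ x).
exists h; split.
- by apply: tens_unitl_ext => x; rewrite ev_comp mlunitE hE ev_id.
- by apply: (@ev_inj _ U) => x; rewrite ev_comp hE mlunitE ev_id.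
Qed.

Lemma mbraid_iso A B : is_iso (mbraid A B).
Proof. by exists (mbraid B A); rewrite !mbraidK. Qed.

Lemma massoc_iso A B D : is_iso (massoc A B D).
Proof.
exists (massocV A B D); split.
- by apply: tens_ext3 => x y z; rewrite ev_comp massocE massocVE ev_id.
- apply: (tens_ext (b0 := m)) => x t; move: t; apply: is_hom_tens_ext => [| |y z].
  + exact: (is_hom_comp (is_hom_ev _) (is_hom_tensr x)).
  + exact: (is_hom_comp (is_hom_ev _) (is_hom_tensr x)).
  + by rewrite ev_comp massocVE massocE ev_id.
Qed.

(** * Naturality and coherence laws *)

Lemma model_symmetric_monoidal : inhabited (symmetric_monoidal T).
Proof.
apply: inhabits; apply: (@SymmetricMonoidal C T I massoc mlunit mrunit mbraid).
- exact: massoc_iso.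
- exact: mlunit_iso.
- by move=> A; apply: is_iso_comp; [apply: mlunit_iso|apply: mbraid_iso].
- move=> A A' B B' D D' f g h; apply: tens_ext3 => x y z.
  by rewrite !(ev_comp, tens_tmap, massocE).
- move=> A A' f; apply: tens_unitl_ext => x.
  by rewrite !(ev_comp, tens_tmap, mlunitE, ev_id).
- move=> A A' f; apply: tens_unitr_ext => x.
  by rewrite [LHS]ev_comp [RHS]ev_comp tens_tmap ev_id !mrunitE.
- move=> A A' B B' f g; apply: (tens_ext (b0 := m)) => x y.
  by rewrite !(ev_comp, tens_tmap, mbraidE).
(* Triangle: the first factor is reduced to tensors [x @@ i], and then [i] to the generator, where
   both unitors are known. *)
- move=> A B; apply: (tens_ext (b0 := m)) => t y; move: t; apply: is_hom_tens_ext.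
  + exact: (is_hom_comp (is_hom_ev _) (is_hom_tensl y)).
  + exact: (is_hom_comp (is_hom_ev _) (is_hom_tensl y)).
  move=> x i; move: i; apply: is_hom_gen_ext.
  + exact: (is_hom_comp (is_hom_ev _) (is_hom_comp (is_hom_tensl y) (is_hom_tensr x))).
  + exact: (is_hom_comp (is_hom_ev _) (is_hom_comp (is_hom_tensl y) (is_hom_tensr x))).
  by rewrite ev_comp massocE !tens_tmap mrunitE mlunitE !ev_id.
(* Pentagon: threefold extensionality leaves [t] in the innermost product of [A] and [B], which is
   split once more. *)
- move=> A B D E; apply: tens_ext3 => t z w; move: t; apply: is_hom_tens_ext.
  + exact: (is_hom_comp (is_hom_ev _) (is_hom_comp (is_hom_tensl w) (is_hom_tensl z))).
  + exact: (is_hom_comp (is_hom_ev _) (is_hom_comp (is_hom_tensl w) (is_hom_tensl z))).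
  by move=> x y; rewrite !(ev_comp, tens_tmap, massocE, ev_id).
- move=> A B D; apply: tens_ext3 => x y z.
  by rewrite !(ev_comp, tens_tmap, massocE, mbraidE, ev_id).
- exact: mbraidK.
Qed.

(** * The tensor-hom adjunction *)

Fact mcurry_subproof A B D (f : hom (A [x] B) D) : exists h : hom A (ihom H B D),
  forall x y, ev U (ihom_hom m (ev U h x)) y = ev U f (x @@ y).
Proof.
have fr x : is_hom (fun y : el U B => ev U f (x @@ y)).
  exact: (is_hom_comp (is_hom_ev f) (is_hom_tensr x)).
pose k x := ihom_of (sval (cid (fr x))).
have kE x y : ev U (ihom_hom m (k x)) y = ev U f (x @@ y).
  by rewrite ihom_ofK; apply: (svalP (cid (fr x))).
have [h hk] : is_hom k.
  (* Linearity of [f] on tensors in the second variable made each [k x] a morphism; linearity in the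
     first makes [k] one. *)
  apply/(is_hom_ihom m) => y.
  apply: eq_is_hom (is_hom_comp (is_hom_ev f) (is_hom_tensl y)) => x.
  by rewrite kE.
by exists h => x y; rewrite hk kE.
Qed.

Definition mcurry A B D (f : hom (A [x] B) D) : hom A (ihom H B D) :=
  sval (cid (mcurry_subproof f)).

Lemma mcurryE A B D (f : hom (A [x] B) D) x y :
  ev U (ihom_hom m (ev U (mcurry f) x)) y = ev U f (x @@ y).
Proof. exact: svalP (cid (mcurry_subproof f)) x y. Qed.

Fact muncurry_subproof A B D (g : hom A (ihom H B D)) :
  bilinear (fun x => ev U (ihom_hom m (ev U g x))).
Proof.
split=> [|x]; last exact: is_hom_ev.
by apply/(is_hom_ihom m); apply: is_hom_ev.
Qed.

Lemma mcurry_bij A B D : bijective (@mcurry A B D).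
Proof.
exists (fun g => tlift (muncurry_subproof g)) => [f|g].
- by apply: (tens_ext (b0 := m)) => x y; rewrite tliftE mcurryE.
- by apply: (@ev_inj _ U) => x; apply: ihom_ext => y; rewrite mcurryE tliftE.
Qed.

Lemma model_closed : inhabited (closed_structure T H).
Proof.
apply: inhabits; apply: (ClosedStructure mcurry_bij) => A A' B B' D D' a b d f.
apply: (@ev_inj _ U) => x; apply: ihom_ext => y.
by rewrite !(ev_comp, mcurryE, ihom_hom_imap, tens_tmap).
Qed.

Theorem model_closed_symmetric_monoidal : is_closed_symmetric_monoidal T H.
Proof. by split; [apply: model_symmetric_monoidal|apply: model_closed]. Qed.
End BilinearModelTheory.

(** * The model of medial racks *)

Definition Rack_med_concrete : concrete Rack_med :=
  @Concrete Rack_med (fun A => rack_sort (sval A)) (fun A B (f : rack_hom _ _) => f)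
    (fun A x => erefl) (fun A B D g f x => erefl) (fun A B f g => @rack_homP _ _ f g).

Lemma Rack_med_is_homP (A B : Rack_med) (f : el Rack_med_concrete A -> el Rack_med_concrete B) :
  is_hom f <-> forall x y : sval A, f (act x y) = act (f x) (f y) :> sval B.
Proof.
split=> [[h hf] x y|fa]; last by exists (RackHom fa).
by rewrite -!hf; apply: (rack_hom_act (h : rack_hom (sval A) (sval B))).
Qed.

(** By self-distributivity, the translation by [act x y] is that of [y] conjugated by that of [x],
    and for [iact x y] by its inverse. If [x] and [y] both act as the generator, so do these
    conjugates. *)
Lemma act_free_rack1 (x y : free_rack unit) : act x y = act (free_gen tt) y.
Proof.
elim/free_rack_ind: x y => [[] //|x y ax ay|x y ax ay] z.
- by rewrite -{1}(iactK x z) -act_act ay -[in RHS](iactK x z) !ax.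
- apply: (@act_inj _ (free_gen tt)); rewrite -{1}(ax (act _ _)).
  by rewrite act_act iactK ay ax.
Qed.

Lemma free_rack1_medial : medial (free_rack unit).
Proof. by move=> x y z a; rewrite !(act_free_rack1 (act _ _)) act_free_rack1 (act_free_rack1 z). Qed.

Definition Rack_med_unit : Rack_med := exist (fun R : rack => medial R) _ free_rack1_medial.

Definition Rack_med_model :
  bilinear_model Rack_med_concrete med_tensor_functor hom_rack_functor.
Proof.
apply: (@BilinearModel Rack_med Rack_med_concrete med_tensor_functor hom_rack_functor
  (fun A B => @med_tens (sval A) (sval B)) _ _ _ _ (fun A B k => k) _ _ _
  Rack_med_unit (free_gen tt)).
- move=> A B; split=> [y|x]; apply/Rack_med_is_homP => u v.
  + exact: med_tens_actl.
  + exact: med_tens_actr.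
- move=> A B D b [bl br].
  have b_actl x1 x2 y : b (act (x2 : sval A) x1) y = act (b x2 y : sval D) (b x1 y).
    exact: (Rack_med_is_homP (b^~ y)).1.
  have b_actr x y1 y2 : b x (act (y2 : sval B) y1) = act (b x y2 : sval D) (b x y1).
    exact: (Rack_med_is_homP (b x)).1.
  by exists (med_tensor_lift (svalP D) b_actl b_actr); apply: med_tensor_liftE.
- by move=> A B D g h; apply: med_tensor_ext.
- by move=> A A' B B' f g x y; apply: med_tensor_mapE.
(* Here the elements of the internal hom are the morphisms themselves. *)
- by move=> A B; exists id.
- by move=> A A' B B' f g k; apply: rack_homP.
- move=> A B D k; split=> [/Rack_med_is_homP kh y|kh]; apply/Rack_med_is_homP => u v.
  + by rewrite kh.
  + by apply: rack_homP => y; apply: ((Rack_med_is_homP _).1 (kh y)).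
- by move=> A x; exists (free_lift (fun=> x)); apply: free_liftE.
- by move=> A g h gh; apply: free_hom_ext => -[].
Qed.

(** * The model of medial GL-racks *)

Definition GLR_med_concrete : concrete GLR_med :=
  @Concrete GLR_med (fun A => rack_sort (sval A)) (fun A B (f : gl_hom _ _) => f)
    (fun A x => erefl) (fun A B D g f x => erefl) (fun A B f g => @gl_homP _ _ f g).

Lemma GLR_med_is_homP (A B : GLR_med) (f : el GLR_med_concrete A -> el GLR_med_concrete B) :
  is_hom f <-> (forall x y : sval A, f (act x y) = act (f x) (f y) :> sval B) /\
               (forall x : sval A, f (gl_u x) = gl_u (f x) :> sval B).
Proof.
split=> [[h hf]|[fa fu]]; last by exists (@GLHom (sval A) (sval B) (RackHom fa) fu).
split=> [x y|x]; rewrite -!hf.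
- exact: (rack_hom_act (h : gl_hom (sval A) (sval B))).
- exact: (gl_hom_u (h : gl_hom (sval A) (sval B))).
Qed.

(** With [y] written as [gl_u] of some [y'], the two compatibility axioms of [gl_u] with [act]
    evaluate [gl_u (act x y')] in two ways. *)
Lemma act_gl_u (R : gl_rack) (x y : R) : act (gl_u x) y = act x y.
Proof. by rewrite -[y]gl_uiK -gl_u_act gl_u_comm. Qed.

Lemma act_gl_free1 (x y : gl_free unit) : act x y = act (gl_free_gen tt) y.
Proof.
elim/gl_free_ind: x y => [[] //|x y ax ay|x y ax ay|x ax|x ax] z.
- by rewrite -{1}(iactK x z) -act_act ay -[in RHS](iactK x z) !ax.
- apply: (@act_inj _ (gl_free_gen tt)); rewrite -{1}(ax (act _ _)).
  by rewrite act_act iactK ay ax.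
(* Neither [gl_u] nor its inverse changes the translation by an element, so the two unary cases
   reduce to the induction hypothesis. *)
- by rewrite act_gl_u ax.
- by rewrite -act_gl_u gl_uiK ax.
Qed.

Lemma gl_free1_medial : medial (gl_free unit).
Proof. by move=> x y z a; rewrite !(act_gl_free1 (act _ _)) act_gl_free1 (act_gl_free1 z). Qed.

Definition GLR_med_unit : GLR_med := exist (fun R : gl_rack => medial R) _ gl_free1_medial.

Definition GLR_med_model :
  bilinear_model GLR_med_concrete gl_med_tensor_functor gl_hom_rack_functor.
Proof.
apply: (@BilinearModel GLR_med GLR_med_concrete gl_med_tensor_functor gl_hom_rack_functor
  (fun A B => @gl_med_tens (sval A) (sval B)) _ _ _ _ (fun A B k => k) _ _ _
  GLR_med_unit (gl_free_gen tt)).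
- move=> A B; split=> [y|x]; apply/GLR_med_is_homP; split=> [u v|u].
  + exact: gl_med_tens_actl.
  + exact: gl_med_tens_ul.
  + exact: gl_med_tens_actr.
  + exact: gl_med_tens_ur.
- move=> A B D b [bl br].
  have b_actl x1 x2 y : b (act (x2 : sval A) x1) y = act (b x2 y : sval D) (b x1 y).
    exact: ((GLR_med_is_homP (b^~ y)).1 _).1.
  have b_actr x y1 y2 : b x (act (y2 : sval B) y1) = act (b x y2 : sval D) (b x y1).
    exact: ((GLR_med_is_homP (b x)).1 _).1.
  have b_ul x y : b (gl_u (x : sval A)) y = gl_u (b x y : sval D).
    exact: ((GLR_med_is_homP (b^~ y)).1 _).2.
  have b_ur x y : b x (gl_u (y : sval B)) = gl_u (b x y : sval D).
    exact: ((GLR_med_is_homP (b x)).1 _).2.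
  exists (gl_med_tensor_lift (svalP D) b_actl b_actr b_ul b_ur).
  exact: gl_med_tensor_liftE.
- by move=> A B D g h; apply: gl_med_tensor_ext.
- by move=> A A' B B' f g x y; apply: gl_med_tensor_mapE.
- by move=> A B; exists id.
- by move=> A A' B B' f g k; apply: gl_homP.
- move=> A B D k; split=> [/GLR_med_is_homP[ka ku] y|kh]; apply/GLR_med_is_homP.
  + by split=> [u v|u]; rewrite (ka, ku).
  (* Both the action and the GL-structure on the internal hom are pointwise, so each identity is
     checked at every [y]. *)
  + split=> [u v|u]; apply: gl_homP => y.
    * exact: ((GLR_med_is_homP _).1 (kh y)).1.
    * exact: ((GLR_med_is_homP _).1 (kh y)).2.
- by move=> A x; exists (gl_free_lift (fun=> x)); apply: gl_free_liftE.
- by move=> A g h gh; apply: gl_free_hom_ext => -[].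
Qed.

Theorem theorem6p7 :
  is_closed_symmetric_monoidal med_tensor_functor hom_rack_functor /\
  is_closed_symmetric_monoidal gl_med_tensor_functor gl_hom_rack_functor.
Proof.
split; first exact: model_closed_symmetric_monoidal Rack_med_model.
exact: model_closed_symmetric_monoidal GLR_med_model.
Qed.
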